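(* Let $\mathscr P=(P,G_P)$ and $\mathscr Q=(Q,G_Q)$ be causal graphical models over $\mathbf X=(X_1,\dots,X_d)$ and $\mathscr P_{\mathcal E}=((P^e,\mathcal I_e))_{e\in\mathcal E}$ a finite nonempty family of interventional distributions generated from $\mathscr P$. For each $e\in\mathcal E$ define $$Q^e(\mathbf X)=\prod_{i\notin\mathcal I_e}Q(X_i\mid\mathbf{PA}_i^{G_Q})\cdot\prod_{j\in\mathcal I_e}P^e(X_j\mid\mathbf{PA}_j^{G_Q}),$$ where $P^e(X_j\mid\mathbf{PA}_j^{G_Q})$, $j\in\mathcal I_e$, are the mechanisms changed as a result of the environment shift. Then $$D_{\mathrm{IKL}}(\mathscr P_{\mathcal E}\|\mathscr Q)=\frac1{|\mathcal E|}\sum_{e\in\mathcal E}D_{\mathrm{KL}}(P^e(\mathbf X)\,\|\,Q^e(\mathbf X)).$$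
   Context: All distributions have densities with respect to Lebesgue measure; $[d]=\{1,\dots,d\}$. A causal graphical model (CGM) $(P,G)$ is a distribution $P$ over $\mathbf X$ with a DAG $G$ on $[d]$ such that $P$ is Markovian w.r.t. $G$: $P(\mathbf X)=\prod_iP(X_i\mid\mathbf{PA}_i^G)$, with $\mathbf{PA}_i^G$ the parents of $X_i$ in $G$. Interventional distributions: each environment $e$ has a target set $\mathcal I_e\subseteq[d]$ and $P^e(\mathbf X)=\prod_{i\in\mathcal I_e}\tilde P(X_i\mid\mathbf{PA}_i^{G_P})\prod_{i\notin\mathcal I_e}P(X_i\mid\mathbf{PA}_i^{G_P})$. Markov projection: $\pi_G(R)=\arg\min_{Q'\text{ Markovian w.r.t. }G}D_{\mathrm{KL}}(R\|Q')=\prod_iR(X_i\mid\mathbf{PA}_i^G)$. The Interventional KL divergence is $$D_{\mathrm{IKL}}(\mathscr P_{\mathcal E}\|\mathscr Q)=\frac1{|\mathcal E|}\sum_{e\in\mathcal E}\Big[\sum_{i\in[d]\setminus\mathcal I_e}\mathbb E_{P^e(\mathbf{pa}_i^{G_Q})}\big[D_{\mathrm{KL}}(P^e(X_i\mid\mathbf{pa}_i^{G_Q})\|Q(X_i\mid\mathbf{pa}_i^{G_Q}))\big]+D_{\mathrm{KL}}(P^e(\mathbf X)\|\pi_{G_Q}(P^e)(\mathbf X))\Big],$$ where $D_{\mathrm{KL}}$ is the KL divergence (absolute continuity assumed) and the expectation is over the conditioning value drawn from $P^e$. *)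

(* Defs.v *)
From HB Require Import structures.
From mathcomp Require Import all_boot all_order all_algebra.
From mathcomp Require Import all_classical all_reals all_analysis.
Set Implicit Arguments. Unset Strict Implicit. Unset Printing Implicit Defensive.
Import Order.TTheory GRing.Theory Num.Theory.
Local Open Scope ring_scope.
Local Open Scope ereal_scope.

(* Points of R^d are d-tuples; the measurable structure on d.-tuple R is the
   product (Borel) sigma-algebra provided by mathcomp-analysis. *)

Section CGM.
Variables (R : realType) (d : nat).

Definition origin : d.-tuple R := [tuple (0%R : R) | _ < d].

Definition upd (x : d.-tuple R) (j : 'I_d) (t : R) : d.-tuple R :=
  [tuple (if k == j then t else tnth x k) | k < d].

Definition int_coord (j : 'I_d) (g : d.-tuple R -> \bar R) : d.-tuple R -> \bar R :=
  fun y => \int[@lebesgue_measure R]_t g (upd y j t).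

(* Iterated Lebesgue integral over the coordinates in S (the other coordinates
   are taken from the base point).  By Tonelli, for a nonnegative measurable
   function this is the Lebesgue integral over R^S. *)
Definition iint (S : {set 'I_d}) (f : d.-tuple R -> \bar R) : d.-tuple R -> \bar R :=
  foldr int_coord f (enum S).

Definition sint (S : {set 'I_d}) (f : d.-tuple R -> \bar R) (x : d.-tuple R) : \bar R :=
  iint S (funepos f) x - iint S (funeneg f) x.

Definition is_density (p : d.-tuple R -> R) : Prop :=
  measurable_fun [set: d.-tuple R] p /\ (forall x, (0 <= p x)%R) /\
  iint [set: 'I_d] (fun x => (p x)%:E) origin = 1.

Definition ae_eq (f g : d.-tuple R -> R) : Prop :=
  iint [set: 'I_d] (fun x => (if f x == g x then 0%R else 1%R)%:E) origin = 0.

(* marginal density of the coordinates in S, as a function on R^d depending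
   only on the coordinates in S *)
Definition marg (S : {set 'I_d}) (p : d.-tuple R -> R) (x : d.-tuple R) : R :=
  fine (iint (~: S) (fun y => (p y)%:E) x).

Definition cond (p : d.-tuple R -> R) (i : 'I_d) (S : {set 'I_d}) (x : d.-tuple R) : R :=
  (marg (i |: S) p x / marg S p x)%R.

Definition edge_of (pa : 'I_d -> {set 'I_d}) : rel 'I_d := fun a b => a \in pa b.
Definition is_dag (pa : 'I_d -> {set 'I_d}) : Prop :=
  forall i j : 'I_d, j \in pa i -> ~~ connect (edge_of pa) i j.

Definition markovian (p : d.-tuple R -> R) (pa : 'I_d -> {set 'I_d}) : Prop :=
  ae_eq p (fun x => \prod_(i < d) cond p i (pa i) x)%R.

Definition is_CGM (p : d.-tuple R -> R) (pa : 'I_d -> {set 'I_d}) : Prop :=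
  is_density p /\ is_dag pa /\ markovian p pa.

Definition markov_proj (pa : 'I_d -> {set 'I_d}) (r : d.-tuple R -> R) : d.-tuple R -> R :=
  fun x => (\prod_(i < d) cond r i (pa i) x)%R.

Definition abs_cont (p q : d.-tuple R -> R) : Prop :=
  iint [set: 'I_d] (fun x => (if q x == 0%R then p x else 0%R)%:E) origin = 0.

Definition KL (p q : d.-tuple R -> R) : \bar R :=
  sint [set: 'I_d] (fun x => (p x * ln (p x / q x))%:E) origin.

(* D_KL(p(X_i | pa) || q(X_i | pa)) at the parent value given by x *)
Definition KL_cond (p q : d.-tuple R -> R) (i : 'I_d) (S : {set 'I_d})
  (x : d.-tuple R) : \bar R :=
  sint [set i] (fun y => (cond p i S y * ln (cond p i S y / cond q i S y))%:E) x.

(* E_{p(pa_S)} [ g(pa_S) ] for g depending only on the coordinates in S *)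
Definition expect_marg (p : d.-tuple R -> R) (S : {set 'I_d})
  (g : d.-tuple R -> \bar R) : \bar R :=
  sint S (fun x => (marg S p x)%:E * g x) origin.

(* P^e is generated from (P, G_P) by intervening on the targets I with the new
   mechanisms tilde P(X_i | PA_i^{G_P}) (given as conditionals of densities pt i) *)
Definition interventional (p : d.-tuple R -> R) (paP : 'I_d -> {set 'I_d})
  (I : {set 'I_d}) (pe : d.-tuple R -> R) : Prop :=
  is_density pe /\
  exists pt : 'I_d -> d.-tuple R -> R,
    (forall i, i \in I -> is_density (pt i)) /\
    ae_eq pe (fun x => (\prod_(i in I) cond (pt i) i (paP i) x) *
                       (\prod_(i in ~: I) cond p i (paP i) x))%R.

Definition D_IKL (E : finType) (pe : E -> d.-tuple R -> R) (I : E -> {set 'I_d})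
  (q : d.-tuple R -> R) (paQ : 'I_d -> {set 'I_d}) : \bar R :=
  ((#|E|%:R)^-1)%:E *
  \sum_(e : E)
    ((\sum_(i in ~: I e)
        expect_marg (pe e) (paQ i) (KL_cond (pe e) q i (paQ i)))
     + KL (pe e) (markov_proj paQ (pe e))).

Definition Q_env (q : d.-tuple R -> R) (paQ : 'I_d -> {set 'I_d})
  (I : {set 'I_d}) (pe : d.-tuple R -> R) : d.-tuple R -> R :=
  fun x => ((\prod_(i in ~: I) cond q i (paQ i) x) *
            (\prod_(j in I) cond pe j (paQ j) x))%R.

End CGM.

(* Main.v *)
(* For a nonnegative density p = P^e write c_i = p(x_i | pa_i) and k_i = q(x_i | pa_i).
   Almost everywhere on {p > 0},
     ln (p / Q^e) = ln (p / prod_i c_i) + sum_(i notin I) ln (c_i / k_i),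
   and averaging p ln (c_i / k_i) first over x_i given pa_i yields the expected conditional
   divergence. Divergences may be +oo, so the splitting of the integral rests on the
   finiteness of every negative part, a consequence of t ln (t / s) >= t - s: the negative
   parts are dominated by prod_i c_i, whose integral is at most 1 by integrating out sinks
   of the DAG one after the other, and by p(pa_i) k_i. The iterated integrals are treated as
   a positive functional obeying Tonelli's theorem. *)
Require Import Defs.
From HB Require Import structures.
From mathcomp Require Import all_boot all_order all_algebra.
From mathcomp Require Import all_classical all_reals all_analysis.
From mathcomp Require Import measurable_realfun.
Import Order.TTheory GRing.Theory Num.Theory.
Local Open Scope ring_scope.
Local Open Scope ereal_scope.

Set Implicit Arguments.
Unset Strict Implicit.
Unset Printing Implicit Defensive.

(** * Iterated integrals of nonnegative measurable functions: Tonelli, linearity, null sets *)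

Section IteratedIntegral.
Variables (R : realType) (d : nat).
Implicit Types (x y : d.-tuple R) (f g h : d.-tuple R -> \bar R).
Implicit Types (S T : {set 'I_d}) (i j k : 'I_d).

Definition nnmeas f := measurable_fun [set: d.-tuple R] f /\ forall x, 0 <= f x.

Definition indep (B : Type) S (f : d.-tuple R -> B) :=
  forall x j t, j \in S -> f (upd x j t) = f x.

Lemma tnth_upd x j t k : tnth (upd x j t) k = if k == j then t else tnth x k.
Proof. by rewrite tnth_mktuple. Qed.

Lemma upd_comm x j k (s t : R) : j != k ->
  upd (upd x j s) k t = upd (upd x k t) j s.
Proof.
move=> jk; apply/eq_from_tnth => l; rewrite !tnth_upd.
by case: (l =P k) => // ->; rewrite eq_sym (negbTE jk).
Qed.

Lemma upd_upd x j (s t : R) : upd (upd x j s) j t = upd x j t.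
Proof. by apply/eq_from_tnth => l; rewrite !tnth_upd; case: eqP. Qed.

(** Joint measurability in the point and the new value is what Tonelli's theorem asks for when a
    single coordinate is integrated. *)
Lemma measurable_upd j :
  measurable_fun [set: d.-tuple R * measurableTypeR R] (fun z => upd z.1 j z.2).
Proof.
apply/measurable_fun_tnthP => k.
rewrite (_ : _ \o _ = fun z => if k == j then z.2 else tnth z.1 k); last first.
  by apply/funext => z /=; rewrite tnth_upd.
case: (k == j); first exact: measurable_snd.
exact: (measurableT_comp (measurable_tnth k) measurable_fst).
Qed.

Lemma measurable_upd1 x j : measurable_fun [set: measurableTypeR R] (upd x j).
Proof.
apply: (@measurableT_comp _ _ _ _ _ _ _ _ (fun t => (x, t)) (measurable_upd j)).
exact: measurable_pair1.
Qed.

Lemma nnmeas_int_coord j f : nnmeas f -> nnmeas (int_coord j f).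
Proof.
move=> [mf f0]; split; last by move=> x; exact: integral_ge0.
apply: (@measurable_fun_fubini_tonelli_F _ _ _ (measurableTypeR R) R
  (@lebesgue_measure R) (fun z => f (upd z.1 j z.2))) => //.
exact: measurableT_comp mf (measurable_upd j).
Qed.

(** Tonelli on the plane of coordinates [j] and [k], all others frozen at [x]; the two updates
    commute because [j] and [k] differ. *)
Lemma int_coordC j k f : nnmeas f ->
  int_coord j (int_coord k f) = int_coord k (int_coord j f).
Proof.
move=> [mf f0]; have [->//|jk] := eqVneq j k.
apply/funext => x; rewrite /int_coord.
pose F (z : measurableTypeR R * measurableTypeR R) := f (upd (upd x j z.1) k z.2).
have mF : measurable_fun setT F.
  apply: (measurableT_comp mf).
  apply: (@measurableT_comp _ _ _ _ _ _ _ _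
    (fun z => (upd x j z.1, z.2)) (measurable_upd k)).
  apply: measurable_fun_pair => //.
  exact: measurableT_comp (measurable_upd1 x j) measurable_fst.
have FT := @fubini_tonelli _ _ _ _ R (@lebesgue_measure R) (@lebesgue_measure R)
  F mF (fun=> f0 _).
apply: (etrans FT).
by apply: eq_integral => t _; apply: eq_integral => s _; rewrite /F /= upd_comm.
Qed.

Notation iints s f := (foldr (@int_coord R d) f s).

Lemma nnmeas_iints (s : seq 'I_d) f : nnmeas f -> nnmeas (iints s f).
Proof. by move=> nf; elim: s => //= j s IH; exact: nnmeas_int_coord. Qed.

Lemma nnmeas_iint S f : nnmeas f -> nnmeas (iint S f).
Proof. exact: nnmeas_iints. Qed.

Lemma iints_rem j (s : seq 'I_d) f : nnmeas f -> j \in s ->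
  iints s f = int_coord j (iints (rem j s) f).
Proof.
move=> nf; elim: s => //= k s IH; rewrite inE.
case: (eqVneq j k) => [-> //|jk /= js]; rewrite (IH js) /=.
by apply: int_coordC; exact: nnmeas_iints.
Qed.

Lemma iints_perm (s t : seq 'I_d) f : nnmeas f -> perm_eq s t -> iints s f = iints t f.
Proof.
move=> nf; elim: s t => [|j s IH] t.
  by rewrite perm_sym => /perm_nilP ->.
move=> st; have jt : j \in t by rewrite -(perm_mem st) mem_head.
rewrite (iints_rem nf jt) /= (IH (rem j t)) //.
by rewrite -(perm_cons j) (perm_trans st) // perm_to_rem.
Qed.

(** The enumerations of [S] and [T], concatenated, list the union without repetition, and the order
    of integration is immaterial by [iints_perm]. *)
Lemma iint_setU S T f : nnmeas f -> [disjoint S & T] ->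
  iint (S :|: T) f = iint S (iint T f).
Proof.
move=> nf dST; rewrite /iint -foldr_cat; apply: iints_perm => //.
apply: uniq_perm; rewrite ?cat_uniq ?enum_uniq ?andbT //=.
  apply/hasPn => k; rewrite !mem_enum => kT; apply/negP => kS.
  by move/pred0P: dST => /(_ k) /=; rewrite kS kT.
by move=> k; rewrite mem_cat !mem_enum inE.
Qed.

Lemma iint_setT S f : nnmeas f -> iint [set: 'I_d] f = iint S (iint (~: S) f).
Proof.
by move=> nf; rewrite -iint_setU ?finset.setUCr // finset.disjoints_subset finset.setCK.
Qed.

Lemma le_iint S f g x : nnmeas f -> nnmeas g -> (forall y, f y <= g y) ->
  iint S f x <= iint S g x.
Proof.
move=> nf ng fg; rewrite /iint; elim: (enum S) x => //= j s IH x.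
have [mf f0] := nnmeas_iints s nf; have [mg g0] := nnmeas_iints s ng.
apply: ge0_le_integral => //.
- by apply: (measurableT_comp mf); exact: measurable_upd1.
- by apply: (measurableT_comp mg); exact: measurable_upd1.
Qed.

Lemma iintD S f g : nnmeas f -> nnmeas g ->
  iint S (fun y => f y + g y) = fun x => iint S f x + iint S g x.
Proof.
move=> nf ng; rewrite /iint; elim: (enum S) => //= j s ->.
have [mf f0] := nnmeas_iints s nf; have [mg g0] := nnmeas_iints s ng.
apply/funext => x; rewrite /int_coord ge0_integralD //.
- by apply: (measurableT_comp mf); exact: measurable_upd1.
- by apply: (measurableT_comp mg); exact: measurable_upd1.
Qed.

Lemma nnmeasM f g : nnmeas f -> nnmeas g -> nnmeas (fun x => f x * g x).
Proof.
by move=> [mf f0] [mg g0]; split=> [|x];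
  [exact: emeasurable_funM|exact: mule_ge0].
Qed.

Lemma nnmeasD f g : nnmeas f -> nnmeas g -> nnmeas (fun x => f x + g x).
Proof.
by move=> [mf f0] [mg g0]; split=> [|x];
  [exact: emeasurable_funD|exact: adde_ge0].
Qed.

Lemma nnmeas_cst (c : \bar R) : 0 <= c -> nnmeas (fun=> c).
Proof. by move=> c0; split. Qed.

Lemma nnmeas_sum (A : Type) (s : seq A) (P : pred A) (F : A -> d.-tuple R -> \bar R) :
  (forall a, nnmeas (F a)) -> nnmeas (fun x => \sum_(a <- s | P a) F a x).
Proof.
move=> nF; elim: s => [|a s IH].
  by under eq_fun do rewrite big_nil; exact: nnmeas_cst.
under eq_fun do rewrite big_cons.
by case: (P a) => //; exact: nnmeasD.
Qed.

Lemma iint_indepM S c f : nnmeas f -> (forall x, 0 <= c x) -> indep S c ->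
  iint S (fun y => c y * f y) = fun x => c x * iint S f x.
Proof.
move=> nf c0 cS; rewrite /iint.
have : {subset enum S <= S} by move=> k; rewrite mem_enum.
elim: (enum S) => //= j s IH jsS.
rewrite IH => [|k ks]; last by apply: jsS; rewrite inE ks orbT.
have [mf f0] := nnmeas_iints s nf.
apply/funext => x; rewrite /int_coord.
under eq_integral do rewrite cS ?jsS ?mem_head //.
rewrite ge0_integralZl //.
by apply: (measurableT_comp mf); exact: measurable_upd1.
Qed.

Lemma iintZ S (c : \bar R) f x : nnmeas f -> 0 <= c ->
  iint S (fun y => c * f y) x = c * iint S f x.
Proof. by move=> nf c0; rewrite iint_indepM. Qed.

Lemma iint_cst0 S x : iint S (fun=> 0) x = 0 :> \bar R.
Proof.
transitivity (iint S (fun _ : d.-tuple R => 0 * 0 : \bar R) x); first by rewrite mule0.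
by rewrite iintZ ?mul0e //; exact: nnmeas_cst.
Qed.

Lemma iint_sum S (A : Type) (s : seq A) (P : pred A) (F : A -> d.-tuple R -> \bar R) x :
  (forall a, nnmeas (F a)) ->
  iint S (fun y => \sum_(a <- s | P a) F a y) x = \sum_(a <- s | P a) iint S (F a) x.
Proof.
move=> nF; elim: s => [|a s IH].
  by under eq_fun do rewrite big_nil; rewrite big_nil iint_cst0.
under eq_fun do rewrite big_cons; rewrite big_cons; case: (P a) => //.
by rewrite iintD ?IH //; exact: nnmeas_sum.
Qed.

Lemma indep_int_coord j k f : indep [set k] f -> indep [set k] (int_coord j f).
Proof.
move=> fk x l t lk; rewrite /int_coord; apply: eq_integral => s _.
move: lk; rewrite inE => /eqP ->{l}.
have [->|jk] := eqVneq j k; first by rewrite upd_upd.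
by rewrite upd_comm 1?eq_sym // fk // inE.
Qed.

(** Each integrated coordinate is overwritten by the integration variable, and integrating another
    coordinate preserves an existing independence. *)
Lemma indep_iint S T f : indep T f -> indep (S :|: T) (iint S f).
Proof.
move=> fT x j t; rewrite inE /iint => jST.
suff : indep [set j] (iint S f) by apply; rewrite inE.
move: jST; rewrite -mem_enum /iint.
have fj : j \in T -> indep [set j] f.
  by move=> jT y l s; rewrite inE => /eqP ->; exact: fT.
elim: (enum S) => //= k s IH; rewrite inE.
case/orP => [|jT]; last by apply/indep_int_coord/IH; rewrite jT orbT.
case/orP => [/eqP ->|js]; last by apply/indep_int_coord/IH; rewrite js.
move=> y l u; rewrite inE => /eqP ->; rewrite /int_coord.
by apply: eq_integral => v _; rewrite upd_upd.
Qed.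

(** Almost-everywhere comparison, the exceptional set being where a function [h] of zero integral is
    nonzero. Adding [+oo * h] to [g] makes the inequality hold everywhere and costs nothing, since
    [+oo * 0 = 0]. *)
Lemma le_iint_null S f g h x : nnmeas f -> nnmeas g -> nnmeas h ->
  iint S h x = 0 -> (forall y, h y = 0 -> f y <= g y) ->
  iint S f x <= iint S g x.
Proof.
move=> nf ng nh h0 fg.
have nhoo : nnmeas (fun y => +oo * h y) by exact/nnmeasM/nh/nnmeas_cst.
apply: (@le_trans _ _ (iint S (fun y => g y + +oo * h y) x)).
  apply: le_iint => // [|y]; first exact: nnmeasD.
  have := nh.2 y; rewrite le_eqVlt => /orP[/eqP hy|hy].
    by rewrite -hy mule0 adde0 fg.
  rewrite gt0_mulye // addey ?leey //.
  by rewrite gt_eqF // (lt_le_trans _ (ng.2 y)).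
by rewrite iintD // iintZ // h0 mule0 adde0.
Qed.

Lemma eq_iint_null S f g h x : nnmeas f -> nnmeas g -> nnmeas h ->
  iint S h x = 0 -> (forall y, h y = 0 -> f y = g y) ->
  iint S f x = iint S g x.
Proof.
move=> nf ng nh h0 fg; apply/eqP; rewrite eq_le.
by rewrite !(@le_iint_null S _ _ h) // => y /fg ->.
Qed.

Lemma iint_null S f h x : nnmeas f -> nnmeas h ->
  iint S h x = 0 -> (forall y, h y = 0 -> f y = 0) -> iint S f x = 0.
Proof.
move=> nf nh h0 fh.
by rewrite (@eq_iint_null S f (fun=> 0) h) ?iint_cst0 //; exact: nnmeas_cst.
Qed.

Lemma nnmeas_infty_ind f : nnmeas f ->
  nnmeas (fun y => (f y == +oo%E)%:R%:E : \bar R).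
Proof.
move=> nf; split=> [|y]; last by rewrite lee_fin.
apply/measurable_EFinP.
rewrite (_ : (fun _ => _) = \1_(f @^-1` [set +oo%E])); last first.
  by apply/funext => y; rewrite indicE; congr (_%:R); congr nat_of_bool;
    apply/eqP/idP; [exact: mem_set|exact: set_mem].
by apply: measurable_indic; rewrite -[X in measurable X]setTI; exact: nf.1.
Qed.

(** [f] dominates [+oo] times the indicator of its infinite values; a positive integral of that
    indicator would make the integral of [f] infinite. *)
Lemma iint_infty_null S f x : nnmeas f -> iint S f x < +oo ->
  iint S (fun y => (f y == +oo%E)%:R%:E) x = 0.
Proof.
move=> nf foo; have nI := nnmeas_infty_ind nf.
apply/eqP; rewrite eq_le (nnmeas_iint S nI).2 andbT leNgt; apply/negP => I0.
move: foo; apply/negP; rewrite -leNgt -(gt0_mulye I0) -iintZ //.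
apply: le_iint => // [|y]; first exact/nnmeasM/nI/nnmeas_cst.
by case: eqP => [->|_]; rewrite ?mule0 ?mule1 // nf.2.
Qed.

End IteratedIntegral.

(** * Signed integrals of differences of nonnegative functions *)

Section SignedIntegral.
Variables (R : realType) (d : nat).
Implicit Types (x y : d.-tuple R) (f g h : d.-tuple R -> \bar R).

(** Subtraction-free form of the splitting of [a - b] into positive and negative parts, so that
    additivity for nonnegative functions can integrate it. *)
Lemma maxe_diff (a b : \bar R) : 0 <= a -> 0 <= b -> b < +oo ->
  maxe (a - b) 0 + b = maxe (- (a - b)) 0 + a.
Proof.
case: b => [b| |] // a0 b0 _; case: a a0 => [a| |] // a0; last by rewrite addye //= maxNye add0e.
rewrite -EFinB -EFinN -!EFin_max -!EFinD; congr (_%:E).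
rewrite opprB; case: (leP a b) => ab.
  by rewrite max_r ?subr_le0 // max_l ?subr_ge0 // add0r subrK.
by rewrite max_l ?subr_ge0 ?(ltW ab) // max_r ?subr_le0 ?(ltW ab) // add0r subrK.
Qed.

Lemma maxe_opp_diff_le (a b : \bar R) : 0 <= a -> 0 <= b -> maxe (- (a - b)) 0 <= b.
Proof.
move=> a0 b0; rewrite ge_max b0 andbT.
case: b b0 => [b| |] // b0; last by rewrite leey.
case: a a0 => [a| |] // a0; rewrite ?leNye //.
by rewrite -EFinB -EFinN lee_fin opprB gerBl.
Qed.

Lemma sub_eq_of_adde_eq (a b s t : \bar R) :
  0 <= s -> s < +oo -> 0 <= t -> t < +oo -> a + t = s + b -> a - s = b - t.
Proof.
case: s => [s| |] //; case: t => [t| |] // _ _ _ _.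
case: a => [a| |]; case: b => [b| |] //.
rewrite -!EFinD => -[ab]; congr (_%:E).
by apply/eqP; rewrite subr_eq addrAC eq_sym subr_eq addrC ab addrC.
Qed.

(** The pair [a], [b] need not be the positive and negative parts of [f]. The negative part is at
    most [b], hence has finite integral, and integrating [maxe_diff] compares the two decompositions
    even when the integral of [a] is infinite. *)
Lemma sint_diff S f a b h x : measurable_fun [set: d.-tuple R] f ->
  nnmeas a -> nnmeas b -> nnmeas h -> iint S h x = 0 ->
  (forall y, b y < +oo) -> iint S b x < +oo ->
  (forall y, h y = 0 -> f y = a y - b y) ->
  sint S f x = iint S a x - iint S b x.
Proof.
move=> mf na nb nh h0 b_fin Ib_fin fab.
have np : nnmeas (funepos f).
  by split=> [|y]; [exact: measurable_funepos|exact: funepos_ge0].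
have nn : nnmeas (funeneg f).
  by split=> [|y]; [exact: measurable_funeneg|exact: funeneg_ge0].
rewrite /sint; apply: sub_eq_of_adde_eq.
- exact: (nnmeas_iint S nn).2.
- apply: le_lt_trans Ib_fin; apply: (le_iint_null nn nb nh h0) => y /fab fy.
  by rewrite funenegE fy maxe_opp_diff_le // ?na.2 ?nb.2.
- exact: (nnmeas_iint S nb).2.
- exact: Ib_fin.
- have := iintD S np nb; move=> /(congr1 (fun F => F x)) /= <-.
  have := iintD S nn na; move=> /(congr1 (fun F => F x)) /= <-.
  apply: (eq_iint_null _ _ nh h0) => [||y /fab fy]; try exact: nnmeasD.
  by rewrite funeposE funenegE fy maxe_diff // ?na.2 ?nb.2.
Qed.

End SignedIntegral.

(** * Marginals, conditionals, and the mass of products of conditionals along a DAG *)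

Section Conditionals.
Variables (R : realType) (d : nat).
Implicit Types (x y : d.-tuple R) (u v p q : d.-tuple R -> R).
Implicit Types (S T : {set 'I_d}) (i j k : 'I_d).

Definition nnfun u := measurable_fun [set: d.-tuple R] u /\ forall x, (0 <= u x)%R.

Lemma nnfun_nnmeas u : nnfun u -> nnmeas (fun x => (u x)%:E).
Proof. by move=> [mu u0]; split=> [|x]; [exact/measurable_EFinP|rewrite lee_fin]. Qed.

Lemma measurable_fun_inv_ge0 u : nnfun u ->
  measurable_fun [set: d.-tuple R] (fun x => (u x)^-1%R).
Proof.
move=> [mu u0].
(* On nonnegative reals the power of exponent -1 is the inverse, also at 0, where both are 0. *)
rewrite (_ : (fun _ => _) = (@powR R ^~ (-1)%R) \o u); last first.
  by apply/funext => x /=; rewrite powR_inv1.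
by apply: (measurableT_comp _ mu); exact: measurable_powR.
Qed.

Lemma nnfun_div u v : nnfun u -> nnfun v -> nnfun (fun x => u x / v x)%R.
Proof.
move=> nu nv; split=> [|x]; last by rewrite divr_ge0 ?nu.2 ?nv.2.
by apply: measurable_funM nu.1 _; exact: measurable_fun_inv_ge0.
Qed.

Lemma nnfunM u v : nnfun u -> nnfun v -> nnfun (fun x => u x * v x)%R.
Proof.
move=> nu nv; split=> [|x]; last by rewrite mulr_ge0 ?nu.2 ?nv.2.
exact: measurable_funM nu.1 nv.1.
Qed.

Lemma nnfun_prod (A : Type) (s : seq A) (P : pred A) (F : A -> d.-tuple R -> R) :
  (forall a, nnfun (F a)) -> nnfun (fun x => \prod_(a <- s | P a) F a x)%R.
Proof.
move=> nF; elim: s => [|a s IH].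
  by under eq_fun do rewrite big_nil; split.
under eq_fun do rewrite big_cons.
by case: (P a) => //; exact: nnfunM.
Qed.

Lemma nnfun_marg S p : nnfun p -> nnfun (marg S p).
Proof.
move=> np; have nI := nnmeas_iint (~: S) (nnfun_nnmeas np); split=> [|x].
  exact: measurableT_comp (fine_measurable _) nI.1.
exact/fine_ge0/nI.2.
Qed.

Lemma nnfun_cond i S p : nnfun p -> nnfun (cond p i S).
Proof. by move=> np; apply: nnfun_div; exact: nnfun_marg. Qed.

Lemma indep_marg S p : indep (~: S) (marg S p).
Proof.
move=> x j t jS; congr fine.
suff : indep (~: S) (iint (~: S) (fun y => (p y)%:E)) by apply.
rewrite -[X in indep X _](finset.setU0 (~: S)); apply: indep_iint => y k s.
by rewrite inE.
Qed.

Lemma indep_cond i S p : indep (~: (i |: S)) (cond p i S).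
Proof.
move=> x j t jS; rewrite /cond !indep_marg //.
by apply: fintype.subsetP jS; rewrite finset.setCS finset.subsetUr.
Qed.

(** [fine] sends an infinite integral to 0, so only an inequality holds in general. *)
Lemma marg_le S p x : nnfun p -> (marg S p x)%:E <= iint (~: S) (fun y => (p y)%:E) x.
Proof.
move=> np; have := (nnmeas_iint (~: S) (nnfun_nnmeas np)).2 x.
by rewrite /marg; case: iint.
Qed.

Lemma iint_setC_set1 i S f : nnmeas f -> i \notin S ->
  iint [set i] (iint (~: (i |: S)) f) = iint (~: S) f :> (d.-tuple R -> \bar R).
Proof.
move=> nf iS; rewrite -iint_setU //; last first.
  by rewrite disjoints1 !inE eqxx.
congr (iint _ f); apply/setP => k; rewrite !inE.
by case: eqVneq => [->|].
Qed.

(** The denominator is constant in coordinate [i], and the numerator integrates to at most the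
    integral defining it. Where that integral is 0 or infinite, [marg S p x] is 0 and the convention
    [x / 0 = 0] makes the conditional vanish, hence the inequality. *)
Lemma iint_cond_le1 i S p x : nnfun p -> i \notin S ->
  iint [set i] (fun y => (cond p i S y)%:E) x <= 1.
Proof.
move=> np iS.
under eq_fun do rewrite /cond mulrC EFinM.
have nm := nnfun_marg S np; have nmi := nnfun_marg (i |: S) np.
rewrite iint_indepM; first last.
- move=> y j t; rewrite inE => /eqP ->{j}.
  by rewrite indep_marg // inE.
- by move=> y; rewrite lee_fin invr_ge0 nm.2.
- exact: nnfun_nnmeas.
have le_M : iint [set i] (fun y => (marg (i |: S) p y)%:E) x <=
    iint (~: S) (fun y => (p y)%:E) x.
  rewrite -(iint_setC_set1 (nnfun_nnmeas np) iS); apply: le_iint.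
  - exact: nnfun_nnmeas.
  - exact/nnmeas_iint/nnfun_nnmeas.
  - by move=> y; exact: marg_le.
apply: (le_trans (lee_wpmul2l _ le_M)); first by rewrite lee_fin invr_ge0 nm.2.
have := (nnmeas_iint (~: S) (nnfun_nnmeas np)).2 x.
rewrite /marg; case: iint => [r| |] //= r0; last by rewrite invr0 mul0e.
rewrite -EFinM lee_fin; have [->|r0'] := eqVneq r 0%R; first by rewrite mulr0.
by rewrite mulVf.
Qed.

(** Take a vertex of [T] with the fewest descendants. A child [j] in [T] would have strictly fewer:
    its descendants are among those of [i], and acyclicity excludes [i] itself. *)
Lemma dag_sink (pa : 'I_d -> {set 'I_d}) T i0 : is_dag pa -> i0 \in T ->
  exists2 i, i \in T & forall j, j \in T -> i \notin pa j.
Proof.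
move=> dag i0T.
case: (arg_minnP (fun i => #|connect (edge_of pa) i|) i0T) => i iT imin.
exists i => // j jT; apply/negP => ij.
have := imin j jT; apply/negP; rewrite -ltnNge; apply: proper_card.
apply/properP; split.
  apply/fintype.subsetP => k; rewrite !inE; apply: connect_trans.
  exact: connect1.
by exists i; rewrite inE ?connect0 // (negbTE (dag _ _ ij)).
Qed.

(** Induction on the size of [T]: a sink of [T] occurs in no factor but its own, so integrating it
    out first leaves at most the product over the other vertices. *)
Lemma iint_prod_cond_le1 (pa : 'I_d -> {set 'I_d}) p T x : is_dag pa -> nnfun p ->
  iint T (fun y => (\prod_(i in T) cond p i (pa i) y)%:E) x <= 1.
Proof.
move=> dag np; have [n] := ubnP #|T|; elim: n T => // n IH T Tn.
have [->|[i0 i0T]] := set_0Vmem T.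
  by rewrite /iint enum_set0 /= big_set0.
have [i iT isink] := dag_sink dag i0T.
have ipa j : j \in T -> i \notin pa j by exact: isink.
have nprod T' : nnfun (fun y => \prod_(j in T') cond p j (pa j) y)%R.
  by apply: nnfun_prod => j; exact: nnfun_cond.
rewrite -(finset.setD1K iT) finset.setUC iint_setU; first last.
- by rewrite disjoint_sym disjoints1 !inE eqxx.
- exact: nnfun_nnmeas.
under eq_fun do rewrite finset.setUC (big_setD1 i) ?setU11 //= mulrC
  EFinM finset.setU1K ?setD11 //.
apply: le_trans (IH (T :\ i) _); last first.
  by move: Tn; rewrite (cardsD1 i) iT.
apply: le_iint => [||y].
- by apply: nnmeas_iint; apply: nnmeasM; apply: nnfun_nnmeas => //; exact: nnfun_cond.
- exact: nnfun_nnmeas.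
rewrite iint_indepM.
- rewrite -[leRHS]mule1; apply: lee_wpmul2l; first by rewrite lee_fin (nprod _).2.
  by apply: iint_cond_le1 => //; exact: ipa.
- by apply: nnfun_nnmeas; exact: nnfun_cond.
- by move=> z; rewrite lee_fin; exact: (nprod _).2.
- move=> z j t; rewrite inE => /eqP ->{j}; congr (_%:E).
  apply: eq_bigr => j; rewrite !inE => /andP[ji jT].
  by rewrite indep_cond // !inE negb_or eq_sym ji ipa.
Qed.

(** From [ln (1 + u) <= u] at [u = s / t - 1]; if [t] or [s] is 0, the conventions make the left
    side 0. *)
Lemma oppr_xlnx_le (t s : R) : (0 <= t)%R -> (0 <= s)%R -> (- (t * ln (t / s)) <= s)%R.
Proof.
rewrite le_eqVlt => /orP[/eqP <-|t0]; first by rewrite mul0r oppr0.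
rewrite le_eqVlt => /orP[/eqP <-|s0]; first by rewrite invr0 mulr0 ln0 // mulr0 oppr0.
rewrite -mulrN -lnV ?posrE ?divr_gt0 // invf_div.
have : (ln (1 + (s / t - 1)) <= s / t - 1)%R.
  by apply: le_ln1Dx; rewrite ltrBrDl subrr divr_gt0.
rewrite addrC subrK => /(ler_wpM2l (ltW t0)) /le_trans; apply.
by rewrite mulrBr mulr1 mulrCA divff ?gt_eqF // mulr1 gerBl ltW.
Qed.

End Conditionals.

(** * Null sets of marginals and the chain rule for a probability density *)

Section Density.
Variables (R : realType) (d : nat) (p : d.-tuple R -> R).
Hypotheses (np : nnfun p) (p1 : iint [set: 'I_d] (fun x => (p x)%:E) (origin R d) = 1).
Implicit Types (x y : d.-tuple R) (u v : d.-tuple R -> R).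
Implicit Types (S T : {set 'I_d}) (i j k : 'I_d).

Local Notation M S := (iint (~: S) (fun y => (p y)%:E)).

Definition zero_ind u y : \bar R := (u y == 0%R)%:R%:E.

Lemma nnmeas_zero_ind u : nnfun u -> nnmeas (zero_ind u).
Proof.
move=> [mu _]; split=> [|y]; last by rewrite lee_fin.
apply/measurable_EFinP.
rewrite (_ : (fun _ => _) = \1_(u @^-1` [set 0%R])); last first.
  apply/funext => y; rewrite indicE; congr (_%:R); congr nat_of_bool; apply/eqP/idP;
    [exact: mem_set|exact: set_mem].
by apply: measurable_indic; rewrite -[X in measurable X]setTI; exact: mu.
Qed.

Lemma nnmeas_iint_density S : nnmeas (M S).
Proof. exact/nnmeas_iint/nnfun_nnmeas. Qed.

Lemma iint_marg1 S : iint S (M S) (origin R d) = 1.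
Proof. by rewrite -iint_setT //; exact: nnfun_nnmeas. Qed.

(** [marg S p] vanishes either where the true marginal [M S] is 0, so that the product is 0, or
    where it is infinite, which is a null set because the total mass is 1. *)
Lemma marg_zero_null S :
  iint S (fun y => zero_ind (marg S p) y * M S y) (origin R d) = 0.
Proof.
have nM := nnmeas_iint_density S.
have nz := nnmeas_zero_ind (nnfun_marg S np).
apply: (iint_null _ (nnmeas_infty_ind nM)).
- by apply: nnmeasM.
- by apply: iint_infty_null => //; rewrite iint_marg1 ltry.
- move=> y /eqP; rewrite eqe pnatr_eq0 eqb0 => My.
  rewrite /zero_ind /marg; have := nM.2 y.
  case: (iint _ _ y) My => [r| |] //= _ _; case: eqP => [->|_]; first by rewrite mule0.
  by rewrite mul0e.
Qed.

Lemma marg_zero_null_setT S :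
  iint [set: 'I_d] (fun y => zero_ind (marg S p) y * (p y)%:E) (origin R d) = 0.
Proof.
have nz := nnmeas_zero_ind (nnfun_marg S np).
rewrite (iint_setT S); last by apply: nnmeasM => //; exact: nnfun_nnmeas.
rewrite iint_indepM; first exact: marg_zero_null.
- exact: nnfun_nnmeas.
- exact: nz.2.
- by move=> x j t jS; rewrite /zero_ind indep_marg.
Qed.

Lemma marg_zero_null_setU1 i S : i \notin S ->
  iint (i |: S) (fun y => zero_ind (marg S p) y * M (i |: S) y) (origin R d) = 0.
Proof.
move=> iS; have nz := nnmeas_zero_ind (nnfun_marg S np).
have nM := nnmeas_iint_density (i |: S).
rewrite [X in iint X _ _]finset.setUC iint_setU; first last.
- by rewrite disjoint_sym disjoints1.
- by apply: nnmeasM.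
rewrite iint_indepM //; first last.
- move=> x j t; rewrite inE => /eqP ->; rewrite /zero_ind indep_marg //.
  by rewrite inE.
- exact: nz.2.
rewrite iint_setC_set1 //; first exact: marg_zero_null.
exact: nnfun_nnmeas.
Qed.

(** Chain rule p(pa) p(x_i | pa) = p(x_i, pa) almost everywhere; the coordinates outside [i |: S],
    on which [v] does not depend, are then integrated out. *)
Lemma iint_marg_cond i S (v : d.-tuple R -> \bar R) : i \notin S ->
  nnmeas v -> indep (~: (i |: S)) v ->
  iint S (fun y => (marg S p y)%:E *
     iint [set i] (fun z => (cond p i S z)%:E * v z) y) (origin R d) =
  iint [set: 'I_d] (fun y => (p y)%:E * v y) (origin R d).
Proof.
move=> iS nv vi.
have nm := nnfun_nnmeas (nnfun_marg S np).
have nc := nnfun_nnmeas (nnfun_cond i S np).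
have nP := nnfun_nnmeas np.
have nz := nnmeas_zero_ind (nnfun_marg S np).
have nM := nnmeas_iint_density (i |: S).
have nzM := nnmeasM nz nM.
have nMoo := nnmeas_infty_ind nM.
rewrite -iint_indepM; first last.
- by move=> y j t; rewrite inE => /eqP ->; rewrite indep_marg // inE.
- exact: nm.2.
- by apply: nnmeasM.
rewrite -iint_setU; first last.
- by rewrite disjoint_sym disjoints1.
- by do 2 apply: nnmeasM => //.
under [in RHS]eq_fun do rewrite muleC.
rewrite (iint_setT (i |: S)); last exact: nnmeasM.
rewrite (iint_indepM nP nv.2 vi) finset.setUC.
(* The chain rule can fail in two ways: the joint marginal is infinite, or [marg S p] is 0 while the
   joint marginal is not. Each summand covers one of them. *)
apply: (@eq_iint_null _ _ _ _ _ (fun y => (M (i |: S) y == +oo%E)%:R%:E +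
    zero_ind (marg S p) y * M (i |: S) y)).
- by do 2 apply: nnmeasM => //.
- by apply: nnmeasM.
- exact: nnmeasD.
- rewrite iintD // marg_zero_null_setU1 // iint_infty_null ?adde0 //.
  by rewrite iint_marg1 ltry.
- move=> y /eqP; rewrite padde_eq0 ?(nzM.2 y) ?(nMoo.2 y) // => /andP[].
  rewrite eqe pnatr_eq0 eqb0 => Moo z0.
  rewrite muleA muleC; congr (_ * _); rewrite -EFinM /cond.
  have [m0|m0] := eqVneq (marg S p y) 0%R.
    move: z0; rewrite /zero_ind m0 eqxx mul1e mul0r => /eqP ->.
    by [].
  rewrite mulrC divfK // /marg fineK // ge0_fin_numE ?nM.2 //.
  by rewrite lt_neqAle Moo leey.
Qed.

Lemma funepos_EFinM u v y : (forall x, (0 <= u x)%R) ->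
  funepos (fun x => (u x * v x)%:E) y = (u y)%:E * funepos (fun x => (v x)%:E) y.
Proof.
by move=> u0; rewrite !funeposE -!EFin_max -EFinM maxr_pMr // mulr0.
Qed.

Lemma funeneg_EFinM u v y : (forall x, (0 <= u x)%R) ->
  funeneg (fun x => (u x * v x)%:E) y = (u y)%:E * funeneg (fun x => (v x)%:E) y.
Proof.
move=> u0; rewrite !funenegE -!EFinN -!EFin_max -EFinM maxr_pMr //.
by rewrite mulr0 mulrN.
Qed.

Lemma measurable_logratio u v : nnfun u -> nnfun v ->
  measurable_fun [set: d.-tuple R] (fun y => ln (u y / v y)%R).
Proof.
move=> nu nv; exact: (measurableT_comp (@measurable_ln R) (nnfun_div nu nv).1).
Qed.

(** * The expected conditional divergence of one mechanism as an integral over the whole space *)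

Section Edge.
Variables (q : d.-tuple R -> R) (i : 'I_d) (S : {set 'I_d}).
Hypotheses (nq : nnfun q) (iS : i \notin S).

Local Notation c := (cond p i S).
Local Notation w y := (ln (cond p i S y / cond q i S y))%R.
Local Notation A_pos := (iint [set i] (funepos (fun y => (c y * w y)%:E))).
Local Notation A_neg := (iint [set i] (funeneg (fun y => (c y * w y)%:E))).

Lemma measurable_cond_logratio :
  measurable_fun [set: d.-tuple R] (fun y => (w y)%:E).
Proof.
by apply/measurable_EFinP; apply: measurable_logratio; exact: nnfun_cond.
Qed.

Lemma nnmeas_funepos_logratio : nnmeas (funepos (fun y => (w y)%:E)).
Proof.
split=> [|y]; last exact: funepos_ge0.
exact: measurable_funepos measurable_cond_logratio.
Qed.

Lemma nnmeas_funeneg_logratio : nnmeas (funeneg (fun y => (w y)%:E)).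
Proof.
split=> [|y]; last exact: funeneg_ge0.
exact: measurable_funeneg measurable_cond_logratio.
Qed.

Lemma indep_logratio : indep (~: (i |: S)) (fun y => w y).
Proof. by move=> x j t jS; rewrite !indep_cond. Qed.

Lemma indep_funepos_logratio : indep (~: (i |: S)) (funepos (fun y => (w y)%:E)).
Proof. by move=> x j t jS; rewrite !funeposE (indep_logratio _ _ jS). Qed.

Lemma indep_funeneg_logratio : indep (~: (i |: S)) (funeneg (fun y => (w y)%:E)).
Proof. by move=> x j t jS; rewrite !funenegE (indep_logratio _ _ jS). Qed.

Lemma funepos_cond_logratio : funepos (fun y => (c y * w y)%:E) =
  fun y => (c y)%:E * funepos (fun y => (w y)%:E) y.
Proof.
by apply/funext => y; apply: funepos_EFinM => x; exact: (nnfun_cond _ _ np).2.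
Qed.

Lemma funeneg_cond_logratio : funeneg (fun y => (c y * w y)%:E) =
  fun y => (c y)%:E * funeneg (fun y => (w y)%:E) y.
Proof.
by apply/funext => y; apply: funeneg_EFinM => x; exact: (nnfun_cond _ _ np).2.
Qed.

Lemma nnmeas_int_funepos : nnmeas A_pos.
Proof.
rewrite funepos_cond_logratio; apply: nnmeas_iint; apply: nnmeasM.
  exact/nnfun_nnmeas/nnfun_cond.
exact: nnmeas_funepos_logratio.
Qed.

Lemma nnmeas_funeneg_cond_logratio : nnmeas (funeneg (fun y => (c y * w y)%:E)).
Proof.
rewrite funeneg_cond_logratio; apply: nnmeasM.
  exact/nnfun_nnmeas/nnfun_cond.
exact: nnmeas_funeneg_logratio.
Qed.

Lemma nnmeas_int_funeneg : nnmeas A_neg.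
Proof. exact/nnmeas_iint/nnmeas_funeneg_cond_logratio. Qed.

(** By [oppr_xlnx_le] the negative part is at most the conditional of [q], whose integral over
    coordinate [i] is at most 1. *)
Lemma int_funeneg_le1 x : A_neg x <= 1.
Proof.
apply: (le_trans _ (iint_cond_le1 x nq iS)); apply: le_iint.
- exact: nnmeas_funeneg_cond_logratio.
- exact/nnfun_nnmeas/nnfun_cond.
- move=> y; rewrite funenegE ge_max -EFinN !lee_fin (nnfun_cond _ _ nq).2 andbT.
  by apply: oppr_xlnx_le; exact: (nnfun_cond _ _ _).2.
Qed.

Lemma iint_marg_int_funeneg_lty :
  iint S (fun y => (marg S p y)%:E * A_neg y) (origin R d) < +oo.
Proof.
have nm := nnfun_nnmeas (nnfun_marg S np).
apply: (@le_lt_trans _ _ 1); last by rewrite ltry.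
rewrite -(iint_marg1 S); apply: le_iint.
- exact: nnmeasM nm nnmeas_int_funeneg.
- exact: nnmeas_iint_density.
- move=> y; apply: le_trans (marg_le S y np).
  by rewrite -[leRHS]mule1; apply: lee_wpmul2l (int_funeneg_le1 y); exact: nm.2.
Qed.

Lemma iint_marg_int_funepos :
  iint S (fun y => (marg S p y)%:E * A_pos y) (origin R d) =
  iint [set: 'I_d] (funepos (fun y => (p y * w y)%:E)) (origin R d).
Proof.
rewrite funepos_cond_logratio (iint_marg_cond iS).
- by congr (iint _ _ _); apply/funext => y; rewrite funepos_EFinM //; exact: np.2.
- exact: nnmeas_funepos_logratio.
- exact: indep_funepos_logratio.
Qed.

Lemma iint_marg_int_funeneg :
  iint S (fun y => (marg S p y)%:E * A_neg y) (origin R d) =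
  iint [set: 'I_d] (funeneg (fun y => (p y * w y)%:E)) (origin R d).
Proof.
rewrite funeneg_cond_logratio (iint_marg_cond iS).
- by congr (iint _ _ _); apply/funext => y; rewrite funeneg_EFinM //; exact: np.2.
- exact: nnmeas_funeneg_logratio.
- exact: indep_funeneg_logratio.
Qed.

(** The chain rule applies to the positive and negative parts of the log-ratio separately; the
    finite negative part lets the nested signed integrals merge into one. *)
Lemma expect_marg_KL_cond :
  expect_marg p S (KL_cond p q i S) =
  sint [set: 'I_d] (fun y => (p y * w y)%:E) (origin R d).
Proof.
have nm := nnfun_nnmeas (nnfun_marg S np).
have nmp := nnmeasM nm nnmeas_int_funepos.
have nmn := nnmeasM nm nnmeas_int_funeneg.
have neg_fin y : A_neg y \is a fin_num.
  rewrite ge0_fin_numE ?(nnmeas_int_funeneg.2 y) //.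
  by rewrite (le_lt_trans (int_funeneg_le1 y)) // ltry.
have mE y : (marg S p y)%:E * KL_cond p q i S y =
    (marg S p y)%:E * A_pos y - (marg S p y)%:E * A_neg y.
  by rewrite /KL_cond /sint muleBr // fin_num_adde_defl // fin_numN.
(* The exceptional set is empty: [A_neg] is finite at every point, so [mE] holds everywhere. *)
rewrite /expect_marg (@sint_diff _ _ _ _ (fun y => (marg S p y)%:E * A_pos y)
  (fun y => (marg S p y)%:E * A_neg y) (fun=> 0)) //.
- by rewrite /sint iint_marg_int_funepos iint_marg_int_funeneg.
- by under eq_fun do rewrite mE; apply: emeasurable_funB nmp.1 nmn.1.
- exact: iint_cst0.
- by move=> y; rewrite -ge0_fin_numE ?nmn.2 // fin_numM.
- exact: iint_marg_int_funeneg_lty.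
Qed.

End Edge.

End Density.

(** * Finite sums of differences, logarithms of products, and regularity of [Q_env] *)

Lemma sume_sub (R : realType) (A : Type) (s : seq A) (P : pred A) (F G : A -> \bar R) :
  (forall a, G a \is a fin_num) ->
  \sum_(a <- s | P a) (F a - G a) = \sum_(a <- s | P a) F a - \sum_(a <- s | P a) G a.
Proof.
move=> Gfin; elim: s => [|a s IH]; first by rewrite !big_nil sube0.
rewrite !big_cons; case: (P a) => //; rewrite IH.
by rewrite [X in _ = _ - X]addeC fin_num_oppeD // [X in _ = _ + X]addeC addeACA.
Qed.

Lemma ln_prod (R : realType) (A : Type) (s : seq A) (P : pred A) (F : A -> R) :
  (forall a, P a -> (0 < F a)%R) ->
  (ln (\prod_(a <- s | P a) F a) = \sum_(a <- s | P a) ln (F a))%R.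
Proof.
move=> F0; elim: s => [|a s IH]; first by rewrite !big_nil ln1.
rewrite !big_cons; case: ifP => // Pa; rewrite lnM ?IH // posrE ?F0 //.
exact: prodr_gt0.
Qed.

Lemma nnfun_Q_env (R : realType) (d : nat) (q : d.-tuple R -> R)
  (paQ : 'I_d -> {set 'I_d}) (I : {set 'I_d}) (p : d.-tuple R -> R) :
  nnfun q -> nnfun p -> nnfun (Q_env q paQ I p).
Proof.
by move=> nq np; apply: nnfunM; apply: nnfun_prod => i; exact: nnfun_cond.
Qed.

(** * Decomposition of the divergence from [Q_env] in a single environment *)

Section KLDecomposition.
Variables (R : realType) (d : nat) (p q : d.-tuple R -> R).
Variables (pa : 'I_d -> {set 'I_d}) (I : {set 'I_d}).
Hypotheses (np : nnfun p) (p1 : iint [set: 'I_d] (fun x => (p x)%:E) (origin R d) = 1).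
Hypotheses (nq : nnfun q) (dag : is_dag pa) (ac : abs_cont p (Q_env q pa I p)).

Local Notation logratio i y := (ln (cond p i (pa i) y / cond q i (pa i) y))%R.
Local Notation g i := (fun y => (p y * logratio i y)%:E).
Local Notation f1 := (fun y => (p y * ln (p y / markov_proj pa p y))%:E).

Lemma is_dag_irrefl i : i \notin pa i.
Proof. by apply/negP => /dag; rewrite connect0. Qed.

Lemma iint_neg_logratio_lty i :
  iint [set: 'I_d] (funeneg (g i)) (origin R d) < +oo.
Proof.
rewrite -iint_marg_int_funeneg ?is_dag_irrefl //.
exact: iint_marg_int_funeneg_lty (is_dag_irrefl i).
Qed.

Lemma nnfun_markov_proj : nnfun (markov_proj pa p).
Proof. by apply: nnfun_prod => i; exact: nnfun_cond. Qed.

Lemma measurable_xlnx u : nnfun u ->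
  measurable_fun [set: d.-tuple R] (fun y => (p y * ln (p y / u y))%:E).
Proof.
move=> nu; apply/measurable_EFinP/measurable_funM; first exact: np.1.
exact: measurable_logratio.
Qed.

Lemma measurable_xlogratio i : measurable_fun [set: d.-tuple R] (g i).
Proof.
apply/measurable_EFinP/measurable_funM; first exact: np.1.
by apply: measurable_logratio; exact: nnfun_cond.
Qed.

(** The negative part is dominated by the Markov projection itself, whose mass over a DAG is at most
    1. *)
Lemma iint_neg_markov_proj_lty :
  iint [set: 'I_d] (funeneg f1) (origin R d) < +oo.
Proof.
apply: (@le_lt_trans _ _ 1); last by rewrite ltry.
apply: (le_trans _ (iint_prod_cond_le1 [set: 'I_d] (origin R d) dag np)).
have nM : nnmeas (fun y => (\prod_(i in [set: 'I_d]) cond p i (pa i) y)%:E).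
  by apply/nnfun_nnmeas/nnfun_prod => i; exact: nnfun_cond.
apply: le_iint => //.
  split=> [|y]; last exact: funeneg_ge0.
  exact: measurable_funeneg (measurable_xlnx nnfun_markov_proj).
move=> y; rewrite funenegE -EFinN ge_max nM.2 andbT lee_fin.
rewrite (_ : \prod_(i in [set: 'I_d]) _ = markov_proj pa p y)%R.
  apply: oppr_xlnx_le; [exact: np.2|exact: nnfun_markov_proj.2].
by apply: eq_bigl => i; rewrite inE.
Qed.

(* The integral of [junk] vanishes, and where [junk y = 0] and [p y != 0] none of the
   ratios involves the conventions [x / 0 = 0] and [ln 0 = 0]. *)
Definition junk y : \bar R :=
  (if Q_env q pa I p y == 0%R then p y else 0%R)%:E +
  \sum_(i < d) (zero_ind (marg (pa i) p) y * (p y)%:E +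
                zero_ind (marg (i |: pa i) p) y * (p y)%:E).

Lemma nnmeas_abs_cont :
  nnmeas (fun y => (if Q_env q pa I p y == 0%R then p y else 0%R)%:E).
Proof.
rewrite (_ : (fun _ => _) = fun y => zero_ind (Q_env q pa I p) y * (p y)%:E).
  by apply: nnmeasM (nnfun_nnmeas np); apply/nnmeas_zero_ind/nnfun_Q_env.
by apply/funext => y; rewrite /zero_ind; case: ifP; rewrite ?mul1e ?mul0e.
Qed.

Lemma nnmeas_zero_marg S : nnmeas (fun y => zero_ind (marg S p) y * (p y)%:E).
Proof.
by apply: nnmeasM (nnfun_nnmeas np); exact/nnmeas_zero_ind/nnfun_marg.
Qed.

Lemma nnmeas_junk : nnmeas junk.
Proof.
apply: nnmeasD nnmeas_abs_cont _; apply: nnmeas_sum => i.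
by apply: nnmeasD; exact: nnmeas_zero_marg.
Qed.

Lemma iint_junk : iint [set: 'I_d] junk (origin R d) = 0.
Proof.
have nz i : nnmeas (fun y => zero_ind (marg (pa i) p) y * (p y)%:E +
    zero_ind (marg (i |: pa i) p) y * (p y)%:E).
  by apply: nnmeasD; exact: nnmeas_zero_marg.
rewrite iintD; [|exact: nnmeas_abs_cont|exact: nnmeas_sum].
rewrite ac add0e iint_sum // big1 // => i _.
rewrite iintD; [|exact: nnmeas_zero_marg..].
by rewrite !marg_zero_null_setT // adde0.
Qed.

Lemma junk_eq0 y : junk y = 0 -> p y != 0%R ->
  (Q_env q pa I p y != 0%R) /\ forall i, (0 < cond p i (pa i) y)%R.
Proof.
move=> /eqP; have nz i : 0 <= zero_ind (marg (pa i) p) y * (p y)%:E +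
    zero_ind (marg (i |: pa i) p) y * (p y)%:E.
  by rewrite adde_ge0 ?(nnmeas_zero_marg _).2.
rewrite padde_eq0 ?nnmeas_abs_cont.2 ?sume_ge0 // => /andP[Q0 S0] py.
split=> [|i]; first by apply/eqP => Q; move: Q0; rewrite Q eqxx eqe (negbTE py).
have mgt0 S : zero_ind (marg S p) y * (p y)%:E = 0 -> (0 < marg S p y)%R.
  rewrite /zero_ind lt0r (nnfun_marg S np).2 andbT; case: eqP => // _ /eqP.
  by rewrite mul1e eqe (negbTE py).
move: S0; rewrite (bigD1 i) //= padde_eq0 ?sume_ge0 // => /andP[+ _].
rewrite padde_eq0 ?(nnmeas_zero_marg _).2 // => /andP[/eqP/mgt0 m1 /eqP/mgt0 m2].
by rewrite /cond divr_gt0.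
Qed.

Lemma xlnx_Q_env_split y : junk y = 0 ->
  (p y * ln (p y / Q_env q pa I p y) =
   \sum_(i in ~: I) p y * logratio i y + p y * ln (p y / markov_proj pa p y))%R.
Proof.
have [->|py] := eqVneq (p y) 0%R.
  by move=> _; rewrite !mul0r big1 ?addr0 // => i _; rewrite mul0r.
move=> /junk_eq0 /(_ py) [Q0 c0].
have p0 : (0 < p y)%R by rewrite lt0r py np.2.
have k0 i : i \in ~: I -> (0 < cond q i (pa i) y)%R.
  move=> iI; rewrite lt0r (nnfun_cond _ _ nq).2 andbT; apply: contraNneq Q0 => k0.
  by rewrite /Q_env (bigD1 i) //= k0 !mul0r.
have M0 : (0 < markov_proj pa p y)%R by exact: prodr_gt0.
rewrite -mulr_sumr -mulrDr -ln_prod => [|i iI]; last by rewrite divr_gt0 ?k0.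
rewrite -lnM ?posrE ?divr_gt0 //; last first.
  by apply: prodr_gt0 => i iI; rewrite divr_gt0 ?k0.
congr (_ * ln _)%R; rewrite prodf_div.
have -> : markov_proj pa p y =
    ((\prod_(i in ~: I) cond p i (pa i) y) * \prod_(i in I) cond p i (pa i) y)%R.
  rewrite /markov_proj (bigID (mem (~: I))) /=; congr (_ * _)%R.
  by apply: eq_bigl => i; rewrite inE negbK.
(* The conditionals of [p] at the non-targets cancel between the log-ratios and the projection;
   those at the targets remain in the denominator, as in [Q_env]. *)
rewrite /Q_env invfM [in RHS]invfM [RHS]mulrCA mulrACA divff ?mul1r //.
by apply: lt0r_neq0; apply: prodr_gt0.
Qed.

Lemma KL_Q_env_split :
  \sum_(i in ~: I) expect_marg p (pa i) (KL_cond p q i (pa i)) +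
    KL p (markov_proj pa p) = KL p (Q_env q pa I p).
Proof.
have ng_pos i : nnmeas (funepos (g i)).
  split=> [|y]; last exact: funepos_ge0.
  exact: measurable_funepos (measurable_xlogratio i).
have ng_neg i : nnmeas (funeneg (g i)).
  split=> [|y]; last exact: funeneg_ge0.
  exact: measurable_funeneg (measurable_xlogratio i).
have nf_pos : nnmeas (funepos f1).
  split=> [|y]; last exact: funepos_ge0.
  exact: measurable_funepos (measurable_xlnx nnfun_markov_proj).
have nf_neg : nnmeas (funeneg f1).
  split=> [|y]; last exact: funeneg_ge0.
  exact: measurable_funeneg (measurable_xlnx nnfun_markov_proj).
have fin_iint f : nnmeas f -> iint [set: 'I_d] f (origin R d) < +oo ->
    iint [set: 'I_d] f (origin R d) \is a fin_num.
  by move=> nf foo; rewrite ge0_fin_numE ?(nnmeas_iint _ nf).2.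
have posneg (f : d.-tuple R -> \bar R) y : f y = funepos f y - funeneg f y.
  by rewrite {1}(funeposneg f).
have fg i := fin_iint _ (ng_neg i) (iint_neg_logratio_lty i).
have ff := fin_iint _ nf_neg iint_neg_markov_proj_lty.
under eq_bigr do rewrite expect_marg_KL_cond ?is_dag_irrefl //.
(* The integrand is written as the sum of all positive parts minus the sum of all negative parts.
   These differ from its own parts by cancellation, but the subtracted sum has finite integral, and
   outside [junk] the identity is [xlnx_Q_env_split]. *)
rewrite [in RHS]/KL (@sint_diff _ _ _ _
  (fun y => \sum_(i in ~: I) funepos (g i) y + funepos f1 y)
  (fun y => \sum_(i in ~: I) funeneg (g i) y + funeneg f1 y) junk).
- rewrite /KL /sint sume_sub // !iintD //; try exact: nnmeas_sum.
  by rewrite !iint_sum // addeACA fin_num_oppeD.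
- exact: measurable_xlnx (nnfun_Q_env _ _ nq np).
- by apply: nnmeasD nf_pos; exact: nnmeas_sum.
- by apply: nnmeasD nf_neg; exact: nnmeas_sum.
- exact: nnmeas_junk.
- exact: iint_junk.
- move=> y; rewrite -ge0_fin_numE ?adde_ge0 ?sume_ge0 // fin_numD.
  rewrite sum_fin_num; apply/andP; split; last by rewrite funenegE -EFinN -EFin_max.
  by apply/allP => _ /mapP[i _ ->]; rewrite /= funenegE -EFinN -EFin_max.
- rewrite iintD //; last exact: nnmeas_sum.
  apply: lte_add_pinfty iint_neg_markov_proj_lty; rewrite iint_sum //.
  by apply: lte_sum_pinfty => i _; exact: iint_neg_logratio_lty.
- move=> y /xlnx_Q_env_split ->.
  rewrite fin_num_oppeD; last first.
    by rewrite funenegE -EFinN -EFin_max.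
  rewrite addeACA -sume_sub => [|i]; last by rewrite funenegE -EFinN -EFin_max.
  rewrite EFinD -sumEFin; congr (_ + _).
    by apply: eq_bigr => i _; exact: posneg (g i) y.
  exact: posneg f1 y.
Qed.

End KLDecomposition.

(** The identity already holds in each environment before averaging; absolute continuity keeps the
    log-ratios at the non-targets meaningful almost everywhere for [pe e]. *)
Theorem theorem16 (R : realType) (d : nat)
  (p : d.-tuple R -> R) (paP : 'I_d -> {set 'I_d})
  (q : d.-tuple R -> R) (paQ : 'I_d -> {set 'I_d})
  (E : finType) (I : E -> {set 'I_d}) (pe : E -> d.-tuple R -> R) :
  (0 < #|E|)%N ->
  is_CGM p paP ->
  is_CGM q paQ ->
  (forall e, interventional p paP (I e) (pe e)) ->
  (forall e, abs_cont (pe e) (Q_env q paQ (I e) (pe e))) ->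
  D_IKL pe I q paQ =
  ((#|E|%:R)^-1)%:E * \sum_(e : E) KL (pe e) (Q_env q paQ (I e) (pe e)).
Proof.
move=> _ _ [[mq [q0 _]] [dag _]] int ac; congr (_ * _).
apply: eq_bigr => e _; have [[mp [p0 p1]] _] := int e.
exact: KL_Q_env_split.
Qed.
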